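(* Let $G$ be a finite directed graph, $r\in V(G)$ with positive in-degree and positive out-degree, and $\lambda,\delta\in(0,1)$. Let \[ \omega=\frac{C}{\lambda^2}\left(\lfloor \log_2(VD(G)-2)\rfloor+1+\log\frac{2}{\delta}\right). \] Run the sampling loop of algorithm ABAD (described in the context), and for a positive integer $\boldsymbol{\tau}<\omega$ let $\mathbf{c}=\frac{1}{\boldsymbol{\tau}}\sum_{\tau=1}^{\boldsymbol{\tau}}\mathbf{c}_\tau$ be the estimate after $\boldsymbol{\tau}$ iterations. Then for all $\delta_1,\delta_2\in(0,1)$, \[ \mathbb{P}\left[bc(r)-\mathbf{c}\le -A\right]\le\delta_1 \quad\text{and}\quad \mathbb{P}\left[bc(r)-\mathbf{c}\ge B\right]\le\delta_2, \] where \[ A=\frac{1}{\boldsymbol{\tau}}\log\frac{1}{\delta_1}\left(\frac13-\frac{\omega\,\alpha(r)}{\boldsymbol{\tau}}+\sqrt{\left(\frac13-\frac{\omega\,\alpha(r)}{\boldsymbol{\tau}}\right)^2+\frac{2\mathbf{c}\,\omega\,\alpha(r)}{\log\frac{1}{\delta_1}}}\right), \] \[ B=\frac{1}{\boldsymbol{\tau}}\log\frac{1}{\delta_2}\left(\frac13+\frac{\omega\,\alpha(r)}{\boldsymbol{\tau}}+\sqrt{\left(\frac13+\frac{\omega\,\alpha(r)}{\boldsymbol{\tau}}\right)^2+\frac{2\mathbf{c}\,\omega\,\alpha(r)}{\log\frac{1}{\delta_2}}}\right). \]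
   Context: $G$ is a finite, unweighted directed graph without self-loops or multiple edges, assumed (weakly) connected. For $s,t\in V(G)$, $\sigma_{st}$ is the number of shortest directed paths from $s$ to $t$ and $\sigma_{st}(v)$ the number of those passing through $v$. Betweenness centrality: $bc(r)=\frac{1}{|V(G)|(|V(G)|-1)}\sum_{s,t\in V(G)\setminus\{r\}}\frac{\sigma_{st}(r)}{\sigma_{st}}$ (terms with $\sigma_{st}=0$ counted as $0$). $\mathcal{RF}(r)$ is the set of vertices $s\ne r$ with a directed path from $s$ to $r$; $\mathcal{RT}(r)$ is the set of vertices $t\ne r$ with a directed path from $r$ to $t$. $\alpha(r)=\frac{|\mathcal{RF}(r)|\,|\mathcal{RT}(r)|}{|V(G)|(|V(G)|-1)}$. The vertex diameter $VD(G)$ is the number of vertices of a longest shortest path in $G$. $C>0$ is a fixed universal constant (the paper estimates it as approximately $0.5$); $\log$ is the natural logarithm. Algorithm ABAD: with $RF=\mathcal{RF}(r)$, $RT=\mathcal{RT}(r)$, in each iteration $\tau$, independently, pick $s\in RF$ and $t\in RT$ uniformly at random and independently; pick a shortest directed path $\pi$ from $s$ to $t$ uniformly at random among all shortest paths from $s$ to $t$; set $\mathbf{c}_\tau=\frac{|RF|\,|RT|}{|V(G)|(|V(G)|-1)}$ if $r$ lies on $\pi$ and $\mathbf{c}_\tau=0$ otherwise.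
   Formalization: The first inequality is stated only when bc(r) > 0 or ωα(r)/τ < 1/3; otherwise A = 0 and c = bc(r) = 0 almost surely, so the printed event has probability 1. When VD(G) = 2 the undefined log_2(0) is read as 0. *)

(* Defs.v *)
From HB Require Import structures.
From mathcomp Require Import all_boot all_order all_algebra.
From mathcomp Require Import all_classical all_reals all_analysis.

Set Implicit Arguments.
Unset Strict Implicit.
Unset Printing Implicit Defensive.

Import Order.TTheory GRing.Theory Num.Theory.

Local Open Scope ring_scope.

Section Digraph.
Variables (V : finType) (e : rel V).

Definition weakly_connected : Prop :=
  forall x y : V, connect (fun u v => e u v || e v u) x y.

Definition indegree (v : V) : nat := #|[set u | e u v]%SET|.
Definition outdegree (v : V) : nat := #|[set u | e v u]%SET|.

(* A directed path is its sequence of vertices, which are pairwise distinct,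
   so that there are at most #|V| of them. *)
Definition vseq : finType := #|V|.-bseq V.

Definition is_dpath (s t : V) (p : seq V) : bool :=
  if p is x :: q then [&& x == s, last x q == t, path e x q & uniq p]
  else false.

Definition shortest_paths (s t : V) : {set vseq} :=
  [set p : vseq | is_dpath s t p
     && [forall q : vseq, is_dpath s t q ==> (size p <= size q)%N]]%SET.

Definition sigma (s t : V) : nat := #|shortest_paths s t|.

Definition sigma_via (s t v : V) : nat :=
  #|[set p in shortest_paths s t | v \in (p : seq V)]%SET|.

Definition vertex_diameter : nat :=
  (\max_(s : V) \max_(t : V) \max_(p in shortest_paths s t) size p)%N.

Definition reach_from (r : V) : {set V} := [set s | (s != r) && connect e s r]%SET.
Definition reach_to (r : V) : {set V} := [set t | (t != r) && connect e r t]%SET.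

End Digraph.

Section Centrality.
Variables (R : realType) (V : finType) (e : rel V).

(* Division by zero yields 0, so pairs with sigma e s t = 0 contribute 0. *)
Definition bc (r : V) : R :=
  (#|V|%:R * (#|V|%:R - 1))^-1 *
  \sum_(s : V | s != r) \sum_(t : V | t != r)
    (sigma_via e s t r)%:R / (sigma e s t)%:R.

Definition alpha (r : V) : R :=
  #|reach_from e r|%:R * #|reach_to e r|%:R / (#|V|%:R * (#|V|%:R - 1)).

(* When the vertex diameter is 2 the logarithm of 0 is read as 0, the
   library's value of ln outside the positive reals. *)
Definition omega (C lambda delta : R) : R :=
  C / lambda ^+ 2 *
  ((Num.floor (ln ((vertex_diameter e)%:R - 2 : R) / ln (2 : R)))%:~R + 1
   + ln (2 / delta)).

End Centrality.

Section ABAD.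
Variables (R : realType) (V : finType) (e : rel V) (r : V).

(* One iteration draws the source, the target and the path between them. *)
Definition draw : finType := (V * V * vseq V)%type.

Definition uniform_pmf (T : finType) (A : {set T}) (x : T) : R :=
  if x \in A then (#|A|%:R)^-1 else 0.

Definition draw_pmf (x : draw) : R :=
  let: (s, t, p) := x in
  uniform_pmf (reach_from e r) s * uniform_pmf (reach_to e r) t
  * uniform_pmf (shortest_paths e s t) p.

Definition draw_value (x : draw) : R :=
  if r \in (x.2 : seq V) then
    #|reach_from e r|%:R * #|reach_to e r|%:R / (#|V|%:R * (#|V|%:R - 1))
  else 0.

Local Open Scope classical_set_scope.

Variables (d : measure_display) (Omega : measurableType d).
Variables (P : probability Omega R) (n : nat) (X : 'I_n -> Omega -> draw).

(* Mutual independence: choosing A i to be the full set gives the product rule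
   for the subfamilies. *)
Definition mutually_independent : Prop :=
  forall A : 'I_n -> {set draw},
    P (\bigcap_(i in [set: 'I_n]) [set w | X i w \in A i])
    = (\prod_(i < n) P [set w | X i w \in A i])%E.

Record abad_run : Prop := AbadRun {
  abad_measurable : forall i x, measurable [set w | X i w = x] ;
  abad_law : forall i x, P [set w | X i w = x] = (draw_pmf x)%:E ;
  abad_independent : mutually_independent }.

Definition estimate (w : Omega) : R :=
  (n%:R)^-1 * \sum_(i < n) draw_value (X i w).

End ABAD.

Section Bounds.
Variable R : realType.

(* w, a, c and d stand for omega, alpha(r), the estimate and delta_1 or
   delta_2. *)
Definition bound_A (tau : nat) (w a c d : R) : R :=
  (tau%:R)^-1 * ln (1 / d) *
  (1 / 3 - w * a / tau%:R
   + Num.sqrt ((1 / 3 - w * a / tau%:R) ^+ 2 + 2 * c * w * a / ln (1 / d))).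

Definition bound_B (tau : nat) (w a c d : R) : R :=
  (tau%:R)^-1 * ln (1 / d) *
  (1 / 3 + w * a / tau%:R
   + Num.sqrt ((1 / 3 + w * a / tau%:R) ^+ 2 + 2 * c * w * a / ln (1 / d))).

End Bounds.

(* Main.v *)
(* Each sample equals alpha(r) with some probability p and 0 otherwise, and
   alpha(r) p = bc(r), since only pairs in RF(r) x RT(r) have a shortest path
   through r. As alpha(r) <= 1, the samples satisfy Bernstein's inequality with
   total variance at most tau alpha(r) bc(r) <= omega alpha(r) bc(r). With
   L = log(1/delta) and y = tau (c - bc(r)) or y = tau (bc(r) - c), squaring the
   square root in A or B and eliminating c turns the event into
   y > 0 and y^2 >= 2 L (omega alpha(r) bc(r) + y / 3), which is exactly the
   event to which Bernstein's inequality assigns probability at most delta. *)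

Require Import Defs.
From HB Require Import structures.
From mathcomp Require Import all_boot all_order all_algebra.
From mathcomp Require Import all_classical all_reals all_analysis.
From mathcomp Require Import ring lra.

Import Order.TTheory GRing.Theory Num.Theory.
Import numFieldNormedType.Exports.

Local Open Scope classical_set_scope.
Local Open Scope ring_scope.

(** * Quadratic bounds on the exponential function *)

Lemma is_derive_ge0_homo (R : realType) (f g : R -> R) :
  (forall x : R, is_derive x (1 : R) f (g x)) -> (forall x, 0 <= x -> 0 <= g x) ->
  forall x, 0 <= x -> f 0 <= f x.
Proof.
move=> df g0 x x0; apply: (@ger0_derive1_le_cc R f 0 x) => //.
- by move=> y; rewrite in_itv /= => /andP[/ltW y0 _]; rewrite derive1E derive_val g0.
- by apply: derivable_within_continuous => y _; exact: ex_derive.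
- by rewrite in_itv /= lexx.
- by rewrite in_itv /= lexx x0.
Qed.

(** For [u = - v], the function e^v (1 - v + v^2 / 2) has derivative e^v v^2 / 2 >= 0 and value 1 at
    0. *)
Lemma expRN_le_quadratic (R : realType) (u : R) :
  u <= 0 -> expR u <= 1 + u + u ^+ 2 / 2.
Proof.
move=> u0; have [v v0 ->] : exists2 v : R, 0 <= v & u = - v.
  by exists (- u); rewrite ?opprK ?oppr_ge0.
have := @is_derive_ge0_homo R (fun x => expR x * (1 - x + x ^+ 2 / 2))
  (fun x => expR x * (x ^+ 2 / 2)).
move=> /(_ _ _ v v0); rewrite expR0 subr0 expr0n /= mul0r addr0 mulr1.
rewrite expRN sqrrN => H; rewrite -[leLHS]mulr1 ler_pdivrMl ?expR_gt0 //; apply: H.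
- by move=> x; apply: is_derive_eq; rewrite /GRing.scale /=; field.
- by move=> x _; rewrite mulr_ge0 ?expR_ge0 // divr_ge0 ?sqr_ge0.
Qed.

(** For u < 3 this is e^u <= 1 + u + u^2 / (2 (1 - u / 3)) with the denominator cleared. The
    difference of the two sides and its first two derivatives vanish at 0, and its third derivative
    is 2 u e^u >= 0. *)
Lemma expR_le_bernstein (R : realType) (u : R) :
  0 <= u -> expR u * (6 - 2 * u) <= 6 + 4 * u + u ^+ 2.
Proof.
have F2 (x : R) : 0 <= x -> 0 <= 2 - expR x * (2 - 2 * x).
  move=> x0; apply: le_trans (@is_derive_ge0_homo R
    (fun x => 2 - expR x * (2 - 2 * x)) (fun x => expR x * (2 * x)) _ _ x x0).
  - by rewrite expR0; lra.
  - by move=> y; apply: is_derive_eq; rewrite /GRing.scale /=; ring.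
  - by move=> y y0; rewrite mulr_ge0 ?expR_ge0 // mulr_ge0.
have F1 (x : R) : 0 <= x -> 0 <= 4 + 2 * x - expR x * (4 - 2 * x).
  move=> x0; apply: le_trans (@is_derive_ge0_homo R
    (fun x => 4 + 2 * x - expR x * (4 - 2 * x)) (fun x => 2 - expR x * (2 - 2 * x)) _ F2 x x0).
  - by rewrite expR0; lra.
  - by move=> y; apply: is_derive_eq; rewrite /GRing.scale /=; ring.
move=> u0; rewrite -subr_ge0; apply: le_trans (@is_derive_ge0_homo R
    (fun x => 6 + 4 * x + x ^+ 2 - expR x * (6 - 2 * x))
    (fun x => 4 + 2 * x - expR x * (4 - 2 * x)) _ F1 u u0).
- by rewrite expR0; lra.
- by move=> y; apply: is_derive_eq; rewrite /GRing.scale /=; ring.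
Qed.

(** Since t z <= t, putting [t] for t z in the denominator only enlarges the bound and gives one
    factor for all z <= 1, of either sign. *)
Lemma expR_le_quadratic (R : realType) (t z : R) : 0 <= t < 3 -> z <= 1 ->
  expR (t * z) <= 1 + t * z + z ^+ 2 * (t ^+ 2 / (2 * (1 - t / 3))).
Proof.
move=> /andP[t0 t3] z1.
have q0 : 0 < 2 * (1 - t / 3) by lra.
rewrite mulrA -exprMn [z * t]mulrC; set u := t * z.
have ut : u <= t by rewrite /u -[leRHS]mulr1 ler_wpM2l.
rewrite -lerBlDl ler_pdivlMr //.
have [u0|/ltW u0] := leP 0 u.
- have := expR_le_bernstein _ _ u0; have := expR_ge1Dx u; nra.
- have := expRN_le_quadratic _ _ u0; have := expR_ge1Dx u; nra.
Qed.

(** * Bernstein's inequality for independent two-valued variables *)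

(** Averaging the pointwise bound cancels the linear term, as the mean is 0; then 1 + x <= e^x. *)
Lemma bernoulli_mgf_le (R : realType) (p z1 z0 t : R) :
  0 <= p <= 1 -> z1 <= 1 -> z0 <= 1 -> p * z1 + (1 - p) * z0 = 0 ->
  0 <= t < 3 ->
  p * expR (t * z1) + (1 - p) * expR (t * z0) <=
  expR ((p * z1 ^+ 2 + (1 - p) * z0 ^+ 2) * (t ^+ 2 / (2 * (1 - t / 3)))).
Proof.
move=> /andP[p0 p1] z11 z01 mean0 t03; apply: le_trans (expR_ge1Dx _).
have := expR_le_quadratic _ _ _ t03 z11; have := expR_le_quadratic _ _ _ t03 z01.
set q := t ^+ 2 / _ => h0 h1.
have {}h1 := ler_wpM2l p0 h1.
have {}h0 : (1 - p) * _ <= (1 - p) * _ := ler_wpM2l (_ : 0 <= 1 - p) h0.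
rewrite (le_trans (lerD h1 (h0 _))) ?subr_ge0 // le_eqVlt; apply/orP; left; apply/eqP.
rewrite -[RHS]addr0 -(mulr0 t) -mean0; ring.
Qed.

(* Chernoff's method: the exponential moment of a sum of independent
   two-valued variables factors by expanding the product over subsets. *)
Lemma bernoulli_chernoff (R : realType) (n : nat) (p z1 z0 t x : R)
    (Q : pred {set 'I_n}) :
  0 <= p <= 1 -> 0 <= t ->
  (forall S : {set 'I_n}, Q S -> x <= \sum_i (if i \in S then z1 else z0)) ->
  \sum_(S | Q S) \prod_i (if i \in S then p else 1 - p) <=
  expR (- (t * x)) * (p * expR (t * z1) + (1 - p) * expR (t * z0)) ^+ n.
Proof.
move=> /andP[p0 p1] t0 Qx.
have pr0 (S : {set 'I_n}) : 0 <= \prod_i (if i \in S then p else 1 - p).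
  by apply: prodr_ge0 => i _; case: ifP; rewrite ?subr_ge0.
have -> : (p * expR (t * z1) + (1 - p) * expR (t * z0)) ^+ n =
  \sum_(S : {set 'I_n}) (\prod_i (if i \in S then p else 1 - p)) *
     expR (t * \sum_i (if i \in S then z1 else z0)).
  rewrite -[in LHS](card_ord n) -prodr_const bigA_distr /=.
  apply: eq_big => [S|S _]; first by rewrite inE.
  rewrite mulr_sumr expR_sum -big_split /=.
  by apply: eq_bigr => i _; case: ifP.
rewrite mulr_sumr big_mkcond /=; apply: ler_sum => S _; case: ifP => [/Qx xS|_].
  rewrite mulrCA -expRD -[leLHS]mulr1 ler_wpM2l // -expR0 ler_expR addrC subr_ge0.
  by rewrite ler_wpM2l.
by rewrite mulr_ge0 ?mulr_ge0 ?expR_ge0.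
Qed.

(** The threshold is given implicitly, by a quadratic inequality in the deviation y, which is the
    form that A and B lead to. Here [s] bounds the total variance. *)
Lemma bernoulli_bernstein (R : realType) (n : nat) (p z1 z0 s L : R)
    (Q : pred {set 'I_n}) :
  0 <= p <= 1 -> z1 <= 1 -> z0 <= 1 -> p * z1 + (1 - p) * z0 = 0 ->
  n%:R * (p * z1 ^+ 2 + (1 - p) * z0 ^+ 2) <= s -> p = 0 \/ 0 < s -> 0 < L ->
  (forall S : {set 'I_n}, Q S -> let y := \sum_i (if i \in S then z1 else z0) in
     0 < y /\ 2 * L * (s + y / 3) <= y ^+ 2) ->
  \sum_(S | Q S) \prod_i (if i \in S then p else 1 - p) <= expR (- L).
Proof.
move=> p01 z11 z01 mean0 var [p0|s0] L0 Qy.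
  (* Degenerate case: the empty set has y = 0, which [Q] excludes, and any other set has weight
     0. *)
  have z00 : z0 = 0 by move: mean0; rewrite p0; lra.
  rewrite big1 ?expR_ge0 // => S /Qy[+ _]; rewrite z00.
  have [->|[i iS] _] := set_0Vmem S.
    by rewrite big1 ?ltxx // => i _; rewrite inE.
  by rewrite (bigD1 i) //= iS p0 mul0r.
(* x is the positive root of x^2 = 2 L (s + x / 3). *)
pose x := L / 3 + Num.sqrt ((L / 3) ^+ 2 + 2 * L * s).
have Ls : 0 < L * s by rewrite mulr_gt0.
have rx : L / 3 < Num.sqrt ((L / 3) ^+ 2 + 2 * L * s).
  rewrite -[ltLHS]ger0_norm ?divr_ge0 ?ltW // -sqrtr_sqr ltr_sqrt; nra.
have xE : x ^+ 2 = 2 * L * (s + x / 3).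
  have := @sqr_sqrtr R ((L / 3) ^+ 2 + 2 * L * s); rewrite /x; nra.
have xL : 2 * L / 3 < x by rewrite /x; lra.
have x0 : 0 < x by apply: lt_trans xL; lra.
(* With this choice t x = 2 L and s q = L, so the final exponent is - 2 L + L. *)
pose t := 2 * L / x.
have t0 : 0 < t by rewrite /t divr_gt0 // mulr_gt0.
have t3 : t < 3 by rewrite /t ltr_pdivrMr //; lra.
have yx (S : {set 'I_n}) : Q S -> x <= \sum_i (if i \in S then z1 else z0).
  (* The quadratic y^2 - 2 L (s + y / 3) is negative for 0 < y < x. *)
  move=> /Qy /=; set y := \sum_i _ => -[y0 yE]; rewrite leNgt; apply/negP => yx; nra.
have t03 : 0 <= t < 3 by rewrite t3 ltW.
apply: (le_trans (bernoulli_chernoff _ _ _ z1 z0 t x Q p01 (ltW t0) yx)).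
have := bernoulli_mgf_le _ _ _ _ _ p01 z11 z01 mean0 t03.
set q := _ / _ => mgf.
have q0 : 0 <= q by rewrite /q divr_ge0 ?sqr_ge0 //; lra.
have /le_trans -> // : expR (- (t * x)) * (p * expR (t * z1) + (1 - p) * expR (t * z0)) ^+ n
  <= expR (- (t * x)) * expR (s * q).
  rewrite ler_wpM2l ?expR_ge0 //.
  have m0 : 0 <= p * expR (t * z1) + (1 - p) * expR (t * z0).
    by case/andP: p01 => ? ?; rewrite addr_ge0 // mulr_ge0 ?expR_ge0 ?subr_ge0.
  apply: (le_trans (lerXn2r n _ _ mgf)); rewrite ?nnegrE ?expR_ge0 //.
  by rewrite -expRM_natl ler_expR mulrA ler_wpM2r.
rewrite -expRD ler_expR.
have -> : t * x = 2 * L by rewrite /t divfK // gt_eqF.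
have -> : s * q = L; last by lra.
have sE : s = (x ^+ 2 - 2 * L * x / 3) / (2 * L) by rewrite xE; field; rewrite gt_eqF.
rewrite /q /t sE; field; rewrite !gt_eqF //=; lra.
Qed.

(** * Events of a random variable with finite range *)

Section FiniteRange.
Context {d : measure_display} {T : measurableType d} {R : realType}.
Variables (P : probability T R) (I : finType) (f : T -> I).
Hypothesis mf : forall x, measurable [set w | f w = x].

Lemma preimage_pred_bigcup (Q : pred I) :
  [set w | Q (f w)] = \bigcup_(x in [set` enum Q]) [set w | f w = x].
Proof.
apply/seteqP; split=> w /=; first by move=> Qw; exists (f w); rewrite //= mem_enum.
by move=> [x /= + fwx]; rewrite mem_enum -fwx.
Qed.

Lemma measurable_preimage_pred (Q : pred I) : measurable [set w | Q (f w)].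
Proof.
by rewrite preimage_pred_bigcup; apply: fin_bigcup_measurable.
Qed.

Lemma probability_preimage_pred (Q : pred I) :
  P [set w | Q (f w)] = (\sum_(x | Q x) P [set w | f w = x])%E.
Proof.
rewrite preimage_pred_bigcup measure_fin_bigcup //; last first.
  by move=> x y _ _ [w [/= <- <-]].
by rewrite -fsbig_seq ?enum_uniq // big_enum.
Qed.

End FiniteRange.

(** * The law of the set of iterations whose path meets [r] *)

Section Hits.
Variables (R : realType) (V : finType) (e : rel V) (r : V).
Context {d : measure_display} {T : measurableType d} {P : probability T R}.
Variables (n : nat) (X : 'I_n -> T -> draw V).

Definition through : {set draw V} := [set x : draw V | r \in (x.2 : seq V)]%SET.

Definition hit_prob : R := \sum_(x in through) draw_pmf R e r x.

(** The estimate depends on the draws only through this set, so tail events become predicates on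
    subsets of ['I_n]. *)
Definition hits (w : T) : {set 'I_n} := [set i | X i w \in through]%SET.

Hypothesis X_run : abad_run e r P X.

Lemma measurable_draw_in i (A : {set draw V}) : measurable [set w | X i w \in A].
Proof. by apply: measurable_preimage_pred => x; exact: abad_measurable X_run i x. Qed.

Lemma probability_through i : P [set w | X i w \in through] = hit_prob%:E.
Proof.
rewrite (probability_preimage_pred P _ (X i)); last first.
  by move=> x; exact: abad_measurable X_run i x.
by rewrite -sumEFin; apply: eq_bigr => x _; rewrite (abad_law X_run).
Qed.

Lemma probability_not_through i :
  P [set w | X i w \in (~: through)%SET] = (1 - hit_prob)%:E.
Proof.
have -> : [set w | X i w \in (~: through)%SET] = ~` [set w | X i w \in through].
  by apply/seteqP; split=> w /=; rewrite finset.in_setC => /negP.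
rewrite probability_setC; last exact: measurable_draw_in.
by rewrite probability_through.
Qed.

(** Puts the event in the product form to which independence applies. *)
Lemma hitsE (S : {set 'I_n}) : [set w | hits w = S] =
  \bigcap_(i in [set: 'I_n])
     [set w | X i w \in (if i \in S then through else ~: through)%SET].
Proof.
apply/seteqP; split=> w /=.
  by move=> <- i _ /=; case: ifP; rewrite !inE // => ->.
move=> H; apply/setP => i; have := H i Logic.I; rewrite /= inE.
by case: ifP => // _; rewrite inE => /negbTE.
Qed.

Lemma measurable_hits S : measurable [set w | hits w = S].
Proof.
by rewrite hitsE; apply: fin_bigcap_measurable => // i _; exact: measurable_draw_in.
Qed.

Lemma probability_hits (Q : pred {set 'I_n}) : P [set w | Q (hits w)] =
  (\sum_(S | Q S) \prod_i (if i \in S then hit_prob else 1 - hit_prob))%:E.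
Proof.
rewrite (probability_preimage_pred P _ _ measurable_hits) -sumEFin.
apply: eq_bigr => S _; rewrite hitsE (abad_independent X_run) -prodEFin.
apply: eq_bigr => i _; case: ifP => _.
  exact: probability_through.
exact: probability_not_through.
Qed.

Lemma estimateE w :
  estimate R e r X w =
  n%:R^-1 * \sum_(i < n) (if i \in hits w then alpha R e r else 0).
Proof.
by rewrite /estimate; congr (_ * _); apply: eq_bigr => i _; rewrite !inE.
Qed.

End Hits.

(** * Betweenness as a hitting probability, and the range of alpha *)

Section Graph.
Variables (R : realType) (V : finType) (e : rel V) (r : V).

(** Splitting a path at [r] shows that pairs outside RF(r) x RT(r) contribute nothing to bc(r). *)
Lemma sigma_via_connect s t :
  (0 < sigma_via e s t r)%N -> connect e s r && connect e r t.
Proof.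
rewrite card_gt0 => /set0Pn[p]; rewrite !inE => /andP[/andP[+ _]].
case: (p : seq V) => // x q /and4P[/eqP-> /eqP lt sq _].
move=> rq; case/splitPl: rq lt sq => q1 q2 lr; rewrite last_cat cat_path lr => lt /andP[p1 p2].
by apply/andP; split; apply/connectP; [exists q1|exists q2].
Qed.

Lemma sum_uniform_via s t :
  \sum_(p : vseq V | r \in (p : seq V)) uniform_pmf R (shortest_paths e s t) p
  = (sigma_via e s t r)%:R / (sigma e s t)%:R.
Proof.
rewrite -big_mkcondr /= sumr_const -[LHS]mulr_natl; congr (_%:R * _).
by apply: eq_card => p; rewrite [RHS]finset.inE; apply: andbC.
Qed.

Lemma hit_probE : hit_prob R V e r =
  \sum_s \sum_t uniform_pmf R (reach_from e r) s * uniform_pmf R (reach_to e r) t *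
    ((sigma_via e s t r)%:R / (sigma e s t)%:R).
Proof.
transitivity (\sum_s \sum_t \sum_(p : vseq V | r \in (p : seq V)) draw_pmf R e r (s, t, p)).
  rewrite pair_bigA pair_big_dep /=.
  by apply: eq_big => [[[s t] p]|[[s t] p] _] //=; rewrite inE.
apply: eq_bigr => s _; apply: eq_bigr => t _.
by rewrite -sum_uniform_via mulr_sumr.
Qed.

(** The sums agree pair by pair: on RF(r) x RT(r) the set sizes cancel, and elsewhere both terms
    vanish. *)
Lemma alpha_hit_prob : alpha R e r * hit_prob R V e r = bc R e r.
Proof.
rewrite hit_probE /bc !mulr_sumr [RHS]big_mkcond /=; apply: eq_bigr => s _.
rewrite !mulr_sumr; transitivity (\sum_(t : V) (#|V|%:R * (#|V|%:R - 1))^-1 *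
  (if (s != r) && (t != r) then (sigma_via e s t r)%:R / (sigma e s t)%:R else 0 : R)).
  apply: eq_bigr => t _.
  have [stRR|] := boolP ((s \in reach_from e r) && (t \in reach_to e r)).
    case/andP: (stRR) => sF tT.
    have -> : (s != r) && (t != r).
      by move: stRR; rewrite !inE => /andP[/andP[-> _] /andP[-> _]].
    have F0 : #|reach_from e r|%:R != 0 :> R.
      by rewrite pnatr_eq0 -lt0n card_gt0; apply/set0Pn; exists s.
    have T0 : #|reach_to e r|%:R != 0 :> R.
      by rewrite pnatr_eq0 -lt0n card_gt0; apply/set0Pn; exists t.
    rewrite /uniform_pmf sF tT /alpha mulrA; congr (_ * _).
    set N := (_ * (_ - 1))^-1; by field; rewrite T0 F0.
  move=> nRR; have -> : uniform_pmf R (reach_from e r) s * uniform_pmf R (reach_to e r) t = 0.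
    rewrite /uniform_pmf; move: nRR; rewrite negb_and.
    by case/orP => /negbTE->; rewrite ?mul0r ?mulr0.
  case: ifP => [|_]; last by rewrite mul0r !mulr0.
  have [->|/sigma_via_connect/andP[sr rt] /andP[s_r t_r]] := posnP (sigma_via e s t r).
    by rewrite !mul0r !mulr0.
  by move: nRR; rewrite !inE s_r t_r sr rt.
case: ifPn => [sr|_] /=; last by rewrite big1 // => t _; rewrite mulr0.
by rewrite [RHS]big_mkcond /=; apply: eq_bigr => t _; case: ifP; rewrite ?mulr0.
Qed.

Lemma alpha_gt0 : irreflexive e -> (0 < indegree e r)%N -> (0 < outdegree e r)%N ->
  0 < alpha R e r.
Proof.
move=> irr; rewrite !card_gt0 => /set0Pn[u]; rewrite inE => ur /set0Pn[v]; rewrite inE => rv.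
have ne : u != r by apply: contraTneq ur => ->; rewrite irr.
have ve : v != r by apply: contraTneq rv => ->; rewrite irr.
rewrite /alpha divr_gt0 // mulr_gt0 // ?subr_gt0 ?ltr1n ?ltr0n.
- by rewrite card_gt0; apply/set0Pn; exists u; rewrite inE ne connect1.
- by rewrite card_gt0; apply/set0Pn; exists v; rewrite inE ve connect1.
- by apply/card_gt0P; exists r.
- by apply/card_gt1P; exists u, r.
Qed.

Lemma alpha_le1 : alpha R e r <= 1.
Proof.
have sF : (#|reach_from e r| <= #|V|.-1)%N.
  by rewrite -(cardsC1 r) subset_leq_card //; apply/fintype.subsetP => x; rewrite !inE => /andP[].
have sT : (#|reach_to e r| <= #|V|.-1)%N.
  by rewrite -(cardsC1 r) subset_leq_card //; apply/fintype.subsetP => x; rewrite !inE => /andP[].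
have V0 : (0 < #|V|)%N by apply/card_gt0P; exists r.
rewrite /alpha -(natrB _ V0) subn1 -!natrM.
(* On a single vertex the denominator is 0 and the quotient is 0 by convention. *)
have [N0|N0] := posnP (#|V| * #|V|.-1)%N; first by rewrite N0 invr0 mulr0.
by rewrite ler_pdivrMr ?ltr0n // mul1r ler_nat leq_mul // (leq_trans sF) ?leq_pred.
Qed.
End Graph.

(** * From the bounds A and B to the quadratic inequality *)

Section Quadratic.
Variables (R : realType) (n : nat) (w a b c dl : R).
Hypotheses (n0 : (0 < n)%N) (wa0 : 0 < w * a) (c0 : 0 <= c).
Hypothesis dl01 : 0 < dl < 1.

Lemma ln_inv_gt0 : 0 < ln (1 / dl).
Proof. by rewrite ln_gt0 //; case/andP: dl01 => ? ?; rewrite ltr_pdivlMr // mul1r. Qed.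

(** Applied with m = 1/3 - k for A and m = 1/3 + k for B, where k = w a / n. *)
Lemma bound_radicand (m : R) : let rt := Num.sqrt (m ^+ 2 + 2 * c * w * a / ln (1 / dl)) in
  [/\ 0 <= rt, m <= rt, - m <= rt &
    ln (1 / dl) * rt ^+ 2 = ln (1 / dl) * m ^+ 2 + 2 * c * (w * a)].
Proof.
move=> rt; have L0 := ln_inv_gt0.
have K0 : 0 <= 2 * c * w * a / ln (1 / dl).
  by rewrite divr_ge0 ?(ltW L0) // -mulrA mulr_ge0 ?(ltW wa0) // mulr_ge0.
have mrt : `|m| <= rt by rewrite -sqrtr_sqr ler_wsqrtr // lerDl.
split; first exact: sqrtr_ge0.
- exact: le_trans (ler_norm _) mrt.
- by apply: le_trans mrt; rewrite -normrN ler_norm.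
- by rewrite sqr_sqrtr ?addr_ge0 ?sqr_ge0 //; field; rewrite gt_eqF.
Qed.

(** The event says L (1/3 - k + rt) <= y. After isolating L rt and squaring, substituting n c = n b
    + y cancels the terms in k y. *)
Lemma bound_A_quadratic : 0 < b \/ w * a / n%:R < 1 / 3 ->
  b - c <= - bound_A n w a c dl ->
  let y := n%:R * (c - b) in
  0 < y /\ 2 * ln (1 / dl) * (w * a * b + y / 3) <= y ^+ 2.
Proof.
move=> bk; rewrite /bound_A.
have [] := bound_radicand (1 / 3 - w * a / n%:R).
have := ln_inv_gt0; set L := ln _ => L0; set rt := Num.sqrt _.
have N0 : 0 < n%:R :> R by rewrite ltr0n.
move: bk; set k := w * a / n%:R => bk rt0 mrt Nmrt rtE.
have KE : w * a = k * n%:R by rewrite /k divfK // gt_eqF.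
move=> Hy; set y := n%:R * (c - b).
have yrt : L * (1 / 3 - k + rt) <= y.
  by rewrite /y -ler_pdivrMl // mulrA; lra.
have cE : n%:R * c = n%:R * b + y by rewrite /y; ring.
have quad : 2 * L * (w * a * b + y / 3) <= y ^+ 2.
  have h1 : L * rt <= y - L * (1 / 3 - k) by lra.
  have h0 : 0 <= L * rt by rewrite mulr_ge0 // ltW.
  have h2 : (L * rt) ^+ 2 <= (y - L * (1 / 3 - k)) ^+ 2.
    by rewrite ler_sqr ?nnegrE //; exact: le_trans h1.
  have h3 : (L * rt) ^+ 2 = L ^+ 2 * (1 / 3 - k) ^+ 2 + 2 * L * k * (n%:R * b + y).
    rewrite exprMn expr2 -mulrA rtE KE -cE; ring.
  rewrite h3 in h2; rewrite KE; lra.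
split=> //.
have y0 : 0 <= y by apply: le_trans yrt; rewrite mulr_ge0 ?(ltW L0) //; lra.
(* If y = 0, the quadratic inequality contradicts b > 0, and [yrt] contradicts k < 1/3. *)
rewrite lt_def y0 andbT; apply/eqP => yE; case: bk => [b_gt0|k3].
  move: quad; rewrite yE mul0r addr0 expr0n /= leNgt => /negP; apply.
  by apply: mulr_gt0; [lra|exact: mulr_gt0].
move: yrt; rewrite yE leNgt => /negP; apply; rewrite mulr_gt0 //; lra.
Qed.

(** Now n c = n b - y and k enters with the opposite sign, so the terms in k y cancel again; y > 0
    follows from 1/3 + k > 0. *)
Lemma bound_B_quadratic : b - c >= bound_B n w a c dl ->
  let y := n%:R * (b - c) in
  0 < y /\ 2 * ln (1 / dl) * (w * a * b + y / 3) <= y ^+ 2.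
Proof.
rewrite /bound_B.
have [] := bound_radicand (1 / 3 + w * a / n%:R).
have := ln_inv_gt0; set L := ln _ => L0; set rt := Num.sqrt _.
have N0 : 0 < n%:R :> R by rewrite ltr0n.
set k := w * a / n%:R => rt0 mrt Nmrt rtE.
have k0 : 0 <= k by rewrite divr_ge0 ?ltW.
have KE : w * a = k * n%:R by rewrite /k divfK // gt_eqF.
move=> Hy; set y := n%:R * (b - c).
have yrt : L * (1 / 3 + k + rt) <= y.
  by rewrite /y -ler_pdivrMl // mulrA; lra.
have cE : n%:R * c = n%:R * b - y by rewrite /y; ring.
split; first by apply: lt_le_trans yrt; rewrite mulr_gt0 //; lra.
have h1 : L * rt <= y - L * (1 / 3 + k) by lra.
have h0 : 0 <= L * rt by rewrite mulr_ge0 // ltW.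
have h2 : (L * rt) ^+ 2 <= (y - L * (1 / 3 + k)) ^+ 2.
  by rewrite ler_sqr ?nnegrE //; exact: le_trans h1.
have h3 : (L * rt) ^+ 2 = L ^+ 2 * (1 / 3 + k) ^+ 2 + 2 * L * k * (n%:R * b - y).
  rewrite exprMn expr2 -mulrA rtE KE -cE; ring.
rewrite h3 in h2; rewrite KE; lra.
Qed.
End Quadratic.

(** * Bernstein's inequality applied to the sampling loop *)

Section Tails.
Variables (R : realType) (V : finType) (e : rel V) (r : V) (w dl : R) (n : nat).
Context {d : measure_display} {T : measurableType d} {P : probability T R}.
Variable X : 'I_n -> T -> draw V.
Hypotheses (X_run : abad_run e r P X) (n0 : (0 < n)%N) (nw : n%:R < w).
Hypotheses (a0 : 0 < alpha R e r) (dl01 : 0 < dl < 1).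

Lemma hit_prob_ge0_le1 : 0 <= hit_prob R V e r <= 1.
Proof.
have := probability_through R V e r n X X_run (Ordinal n0) => pE.
by rewrite -!lee_fin -pE measure_ge0 probability_le1 //; exact: measurable_draw_in X_run _ _.
Qed.

(** With b = a p, the variance p a^2 - b^2 is at most p a^2 = a b, and n < w. *)
Lemma sample_variance_le (z1 z0 : R) (p := hit_prob R V e r) :
  p * z1 ^+ 2 + (1 - p) * z0 ^+ 2 = p * alpha R e r ^+ 2 - bc R e r ^+ 2 ->
  n%:R * (p * z1 ^+ 2 + (1 - p) * z0 ^+ 2) <= w * alpha R e r * bc R e r.
Proof.
move=> ->; rewrite -alpha_hit_prob -/p; set a := alpha R e r.
have /andP[p0 _] := hit_prob_ge0_le1.
have h : p * a ^+ 2 - (a * p) ^+ 2 <= a * (a * p) by nra.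
have a_ge0 : 0 <= a := ltW a0.
have ap0 : 0 <= a * (a * p) by rewrite !(mulr_ge0 a_ge0).
apply: le_trans (ler_wpM2l (ler0n _ _) h) _.
by rewrite -[leRHS]mulrA; apply: ler_wpM2r => //; exact: ltW.
Qed.

(* [z1] and [z0] are the deviations from the mean contributed by a sample whose
   path meets [r] and by one whose path does not. *)
Lemma deviation_tail (z1 z0 : R) (E : pred {set 'I_n}) (p := hit_prob R V e r) :
  z1 <= 1 -> z0 <= 1 -> p * z1 + (1 - p) * z0 = 0 ->
  p * z1 ^+ 2 + (1 - p) * z0 ^+ 2 = p * alpha R e r ^+ 2 - bc R e r ^+ 2 ->
  (forall S : {set 'I_n}, E S -> let y := \sum_i (if i \in S then z1 else z0) in
     0 < y /\ 2 * ln (1 / dl) * (w * alpha R e r * bc R e r + y / 3) <= y ^+ 2) ->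
  (P [set v | E (hits V r n X v)] <= dl%:E)%E.
Proof.
move=> z11 z01 mean0 var Ey.
rewrite (probability_hits R V e r n X X_run) lee_fin.
have -> : dl = expR (- ln (1 / dl)).
  by case/andP: dl01 => ? _; rewrite div1r lnV ?posrE // opprK lnK.
have p01 := hit_prob_ge0_le1.
apply: (@bernoulli_bernstein R n p z1 z0 (w * alpha R e r * bc R e r)) => //.
- exact: sample_variance_le.
- have w0 : 0 < w by apply: le_lt_trans nw; rewrite ler0n.
  have [->|pN0] := eqVneq p 0; [by left|right].
  have p0 : 0 < p by rewrite lt_def pN0; case/andP: p01.
  by rewrite -alpha_hit_prob; apply: mulr_gt0; exact: mulr_gt0.
- exact: ln_inv_gt0.
Qed.

End Tails.

(** * The two tails of the estimate *)

Lemma sum_affine (R : realType) (n : nat) (S : {set 'I_n}) (a b : R) :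
  (0 < n)%N ->
  \sum_(i < n) (if i \in S then a - b else - b) =
  n%:R * (n%:R^-1 * \sum_(i < n) (if i \in S then a else 0) - b).
Proof.
move=> n0; rewrite mulrBr mulVKf ?pnatr_eq0 -?lt0n //.
rewrite -[n in n%:R * b]card_ord mulr_natl -sumr_const -sumrB.
by apply: eq_bigr => i _; case: ifP; rewrite ?sub0r.
Qed.

Theorem theorem4p8 (R : realType) (V : finType) (e : rel V)
  (e_irr : irreflexive e) (e_conn : weakly_connected e)
  (r : V) (r_in : (0 < indegree e r)%N) (r_out : (0 < outdegree e r)%N)
  (C : R) (C_gt0 : 0 < C)
  (lambda : R) (lambda01 : 0 < lambda < 1)
  (delta : R) (delta01 : 0 < delta < 1)
  (tau : nat) (tau_gt0 : (0 < tau)%N)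
  (tau_lt : tau%:R < omega e C lambda delta)
  (d : measure_display) (Omega : measurableType d) (P : probability Omega R)
  (X : 'I_tau -> Omega -> draw V) (X_run : abad_run e r P X)
  (delta1 : R) (delta1_01 : 0 < delta1 < 1)
  (delta2 : R) (delta2_01 : 0 < delta2 < 1) :
  (* The lower bound fails exactly when bc(r) = 0 and
     omega * alpha(r) / tau >= 1/3: then A = 0 and c = bc(r) almost surely. *)
  (0 < bc R e r \/ omega e C lambda delta * alpha R e r / tau%:R < 1 / 3 ->
   (P [set w | bc R e r - estimate R e r X w
       <= - bound_A tau (omega e C lambda delta) (alpha R e r)
              (estimate R e r X w) delta1]%R <= delta1%:E)%E)
  /\
  (P [set w | bc R e r - estimate R e r X w
       >= bound_B tau (omega e C lambda delta) (alpha R e r)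
            (estimate R e r X w) delta2]%R <= delta2%:E)%E.

Proof.
set w := omega _ _ _ _; set a := alpha R e r; set b := bc R e r.
set p := hit_prob R V e r.
have a0 : 0 < a by exact: alpha_gt0.
have a1 : a <= 1 by exact: alpha_le1.
have bE : b = a * p by rewrite /b -alpha_hit_prob.
have /andP[p0 p1] : 0 <= p <= 1 by exact: hit_prob_ge0_le1 X_run tau_gt0.
have wa0 : 0 < w * a by rewrite mulr_gt0 // (le_lt_trans _ tau_lt).
have b0 : 0 <= b by rewrite bE mulr_ge0 // ltW.
have b1 : b <= 1 by rewrite bE mulr_ile1 // ltW.
pose c (S : {set 'I_tau}) : R := tau%:R^-1 * \sum_(i < tau) (if i \in S then a else 0).
have c0 S : 0 <= c S.
  by rewrite mulr_ge0 // sumr_ge0 // => i _; case: ifP => // _; exact: ltW.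
have estE v : estimate R e r X v = c (hits V r tau X v) by rewrite estimateE.
split=> [bk|].
(* Overestimation: a sample deviates from its mean by a - b or - b. *)
- under eq_set do rewrite estE.
  apply: (@deviation_tail R V e r w delta1 tau d Omega P X X_run tau_gt0 tau_lt a0 delta1_01
    (a - b) (- b) (fun S => b - c S <= - bound_A tau w a (c S) delta1)).
  + lra.
  + lra.
  + by rewrite -/p bE; ring.
  + by rewrite -/p -/a -/b bE; ring.
  + move=> S ES; rewrite sum_affine // -/(c S); exact: bound_A_quadratic.
(* Underestimation: the deviations change sign, and b <= 1 keeps them at most 1. *)
- under eq_set do rewrite estE.
  apply: (@deviation_tail R V e r w delta2 tau d Omega P X X_run tau_gt0 tau_lt a0 delta2_01
    (b - a) b (fun S => b - c S >= bound_B tau w a (c S) delta2)).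
  + lra.
  + lra.
  + by rewrite -/p bE; ring.
  + by rewrite -/p -/a -/b bE; ring.
  + move=> S ES.
    have -> : \sum_(i < tau) (if i \in S then b - a else b) = tau%:R * (b - c S).
      rewrite -[b - c S]opprB mulrN -sum_affine // -sumrN.
      by apply: eq_bigr => i _; case: ifP; rewrite ?opprB ?opprK.
    exact: bound_B_quadratic.
Qed.
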